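(* Let $\Gamma=(G,\sigma)$ be a signed graph with $G=(V,E)$, $|V|=n$, with edge weight $w\equiv1$, vertex measure $\mu\equiv1$ and potential $\kappa\equiv0$. Then $(L_1(\Gamma),\dots,L_n(\Gamma))=(0,\dots,0)$ if and only if $E=\emptyset$.
   Context: $G=(V,E)$ is a finite undirected graph without self-loops, $V=\{1,\dots,n\}$; $\sigma:E\to\{\pm1\}$, $\sigma_{ij}=\sigma(\{i,j\})$. For $p\ge1$ and nonzero $f$, $\mathcal R_p^\sigma(f)=\frac{\sum_{\{i,j\}\in E}|f(i)-\sigma_{ij}f(j)|^p}{\sum_i|f(i)|^p}$; $\mathcal S_p=\{f:\sum_i|f(i)|^p=1\}$; Krasnoselskii genus $\gamma(B)$ of closed symmetric $B\subset\mathbb R^n\setminus\{0\}$: least $k$ with an odd continuous map $B\to\mathbb R^k\setminus\{0\}$; $\mathcal F_k(\mathcal S_p)$ = closed symmetric $B\subset\mathcal S_p$ with $\gamma(B)\ge k$; $\lambda_k^{(p)}=\min_{B\in\mathcal F_k(\mathcal S_p)}\max_{f\in B}\mathcal R_p^\sigma(f)$. Cut-off adjacency eigenvalues: $L_k(\Gamma):=\lim_{p\to\infty}2^{-p}\lambda_k^{(p)}(\Gamma)$ (the limits exist). *)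

(* Defs.v *)
From HB Require Import structures.
From mathcomp Require Import all_boot all_order all_algebra.
From mathcomp Require Import all_classical all_reals all_analysis.
Set Implicit Arguments. Unset Strict Implicit. Unset Printing Implicit Defensive.
Import Order.TTheory GRing.Theory Num.Theory.
Import numFieldNormedType.Exports.
Local Open Scope classical_set_scope.
Local Open Scope ring_scope.

(* A graph on V = 'I_n is a symmetric irreflexive relation e; the edge set E
   is the set of unordered pairs {i,j} with e i j; each edge is counted once
   (as the pair with i < j).  sigma i j is the sign of edge {i,j}. *)
Definition simple_graph (n : nat) (e : rel 'I_n) : Prop :=
  (forall i j, e i j = e j i) /\ (forall i, ~~ e i i).

Definition signature (R : realType) (n : nat) (e : rel 'I_n)
  (sigma : 'I_n -> 'I_n -> R) : Prop :=
  (forall i j, sigma i j = sigma j i) /\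
  (forall i j, e i j -> sigma i j = 1 \/ sigma i j = -1).

(* vertex functions f : V -> R are row vectors in R^n *)
Definition ent (R : realType) (n : nat) (f : 'rV[R]_n) (i : 'I_n) : R :=
  f ord0 i.

Definition pnorm_p (R : realType) (n : nat) (p : R) (f : 'rV[R]_n) : R :=
  \sum_(i < n) `|ent f i| `^ p.

(* p-Rayleigh quotient with w = 1, mu = 1, kappa = 0 *)
Definition rayleigh (R : realType) (n : nat) (e : rel 'I_n)
  (sigma : 'I_n -> 'I_n -> R) (p : R) (f : 'rV[R]_n) : R :=
  (\sum_(i < n) \sum_(j < n | (i < j)%N && e i j)
      `|ent f i - sigma i j * ent f j| `^ p) / pnorm_p p f.

Definition sphere_p (R : realType) (n : nat) (p : R) : set 'rV[R]_n :=
  [set f | pnorm_p p f = 1].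

Definition symmetric_set (R : realType) (n : nat) (B : set 'rV[R]_n) : Prop :=
  forall f, B f -> B (- f).

Definition odd_map_to (R : realType) (n : nat) (B : set 'rV[R]_n) (k : nat)
  : Prop :=
  exists g : 'rV[R]_n -> 'rV[R]_k,
    {within B, continuous g} /\
    (forall f, B f -> g (- f) = - g f) /\
    (forall f, B f -> g f != 0).

(* Krasnoselskii genus gamma(B) >= k  (gamma(B) = least such k, +oo if none) *)
Definition genus_ge (R : realType) (n : nat) (B : set 'rV[R]_n) (k : nat)
  : Prop :=
  forall j, (j < k)%N -> ~ odd_map_to B j.

Definition F_k (R : realType) (n : nat) (p : R) (k : nat)
  : set (set 'rV[R]_n) :=
  [set B | closed B /\ symmetric_set B /\ B `<=` @sphere_p R n p /\ genus_ge B k].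

Definition lambda_p (R : realType) (n : nat) (e : rel 'I_n)
  (sigma : 'I_n -> 'I_n -> R) (p : R) (k : nat) : R :=
  inf [set M | exists2 B, @F_k R n p k B & M = sup (rayleigh e sigma p @` B)].

(* Main.v *)
(** The nontrivial point is the Borsuk-Ulam theorem: it says that the genus of the
    unit sphere [S_p] is at least [n].  A symmetric subset of [S_p] missing a point
    [x] maps oddly to [R^(n-1) \ 0] by projection along [x], so [S_p] is the only
    competitor in the min-max defining [lambda_n], which is therefore the maximum
    of the Rayleigh quotient on [S_p]; testing on
    [2^(-1/p) (e_i - sigma_ij e_j)] for an edge [{i, j}] gives
    [lambda_n >= 2^p / 2], hence [L_n >= 1/2].

    Borsuk-Ulam is proved with mod 2 chains of tuples of points.  Start with the
    hemispheres [h_k] of the octahedron, which satisfy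
    [bd h_(k+1) = h_k + (- h_k)], and subdivide them barycentrically.  If
    [p_1, ..., p_m] are odd Boolean functions (the signs of the coordinates of an
    odd map), the number of simplices [v_0, ..., v_m] of [h_m] with
    [p_i v_(i-1) <> p_i v_i] for all [i] is odd: this count is a cup product of
    coboundaries, and Stokes' formula lowers [m] one step at a time.  Hence every
    coordinate of the map changes sign on a common arbitrarily small simplex,
    and by compactness the map has a zero. *)
Require Import Defs.
From HB Require Import structures.
From mathcomp Require Import all_boot all_order all_algebra.
From mathcomp Require Import all_classical all_reals all_analysis.
Set Implicit Arguments.
Unset Strict Implicit.
Unset Printing Implicit Defensive.
Import Order.TTheory GRing.Theory Num.Theory.
Import numFieldNormedType.Exports.
Local Open Scope classical_set_scope.
Local Open Scope ring_scope.

(** * Mod 2 chains *)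

Section Chains.
Variable V : zmodType.
Implicit Types (s t : seq V) (c d : seq (seq V)) (phi : seq V -> bool).

(* A simplex is a tuple of points and a mod 2 chain is a list of simplices, two
   lists being the same chain when [ev phi] agrees on them for all [phi].  The
   empty simplex is allowed, so the complex is augmented. *)
Definition ev phi c := \big[addb/false]_(s <- c) phi s.

Fixpoint bd s : seq (seq V) :=
  if s is v :: s' then s' :: [seq v :: t | t <- bd s'] else [::].

Definition lin (f : seq V -> seq (seq V)) c := flatten [seq f s | s <- c].

Definition antip s := [seq - v | v <- s].

Lemma ev_cat phi c d : ev phi (c ++ d) = ev phi c (+) ev phi d.
Proof. exact: big_cat. Qed.

Lemma ev_cons phi s c : ev phi (s :: c) = phi s (+) ev phi c.
Proof. exact: big_cons. Qed.

Lemma ev_nil phi : ev phi [::] = false.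
Proof. exact: big_nil. Qed.

Lemma ev_map phi (f : seq V -> seq V) c :
  ev phi [seq f s | s <- c] = ev (phi \o f) c.
Proof. exact: big_map. Qed.

Lemma ev_lin phi f c : ev phi (lin f c) = ev (fun s => ev phi (f s)) c.
Proof. by rewrite /ev big_flatten big_map. Qed.

Lemma eq_ev phi psi c : {in c, phi =1 psi} -> ev phi c = ev psi c.
Proof. by move=> e; apply: eq_big_seq. Qed.

Lemma evD phi psi c : ev (fun s => phi s (+) psi s) c = ev phi c (+) ev psi c.
Proof. exact: big_split. Qed.

Lemma ev_andl (b : bool) phi c : ev (fun s => b && phi s) c = b && ev phi c.
Proof. by case: b => //=; rewrite /ev big1. Qed.

Lemma ev_bd phi v s :
  ev phi (bd (v :: s)) = phi s (+) ev (fun t => phi (v :: t)) (bd s).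
Proof. by rewrite /= ev_cons ev_map. Qed.

(** With [v] as apex, the double boundary of [v :: s] is [bd s] taken twice plus the cone over the
    double boundary of [s]; the two copies cancel mod 2. *)
Lemma ev_bdbd phi s : ev phi (lin bd (bd s)) = false.
Proof.
elim: s phi => [|v s IH] phi; first by rewrite ev_nil.
rewrite ev_lin ev_bd.
under [X in _ (+) X]eq_ev do rewrite ev_bd.
by rewrite evD addbA addbb -ev_lin IH.
Qed.

Lemma size_bd s t : t \in bd s -> (size t).+1 = size s.
Proof.
elim: s t => [//|v s IH] t; rewrite /= inE => /predU1P[->//|/mapP[u /IH + ->]].
by move=> /= ->.
Qed.

Lemma mem_bd s t : t \in bd s -> {subset t <= s}.
Proof.
elim: s t => [//|v s IH] t; rewrite /= inE => /predU1P[->|/mapP[u /IH us ->]] w.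
  by rewrite inE orbC => ->.
by rewrite !inE => /predU1P[->|/us ->]; rewrite ?eqxx ?orbT.
Qed.

Lemma bd_antip s : bd (antip s) = [seq antip t | t <- bd s].
Proof.
by elim: s => //= v s ->; rewrite -!map_comp.
Qed.

Fixpoint sign_changes (ps : seq (V -> bool)) s : bool :=
  match ps, s with
  | p :: ps', v :: (w :: _) as s' => (p v (+) p w) && sign_changes ps' s'
  | _, _ => true
  end.

(** A cup product of coboundaries is closed: the face [t] of [v :: t] balances the faces through
    [v]. In the induction the first factors add up by [(p v + p v2) + (p v + p v1) = p v1 + p
    v2]. *)
Lemma sign_changes_cocycle ps v t : size t = (size ps).+1 ->
  ev (fun u => sign_changes ps (v :: u)) (bd t) = sign_changes ps t.
Proof.
elim: ps v t => [|p ps IH] v [//|v1 s].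
  by case: s => // _; rewrite /= ev_cons ev_nil.
case: s => [//|v2 s] [ss]; rewrite ev_bd.
under [X in _ (+) X]eq_ev do rewrite /=.
rewrite /= -[X in ev _ X]/(bd (v2 :: s)) ev_andl IH /= ?ss//.
by rewrite -andb_addl; congr (_ && _); case: (p v); case: (p v1); case: (p v2).
Qed.

(** Leibniz rule: the second factor is a cocycle, so only the coboundary of [p] survives. *)
Lemma sign_changes_coboundary p ps s : size s = (size ps).+2 ->
  ev (fun t => p (head 0 t) && sign_changes ps t) (bd s) =
  sign_changes (p :: ps) s.
Proof.
case: s => [//|v [|w s]] // [ss]; rewrite ev_bd.
under [X in _ (+) X]eq_ev do rewrite /=.
rewrite ev_andl sign_changes_cocycle /= ?ss//.
by rewrite -andb_addl addbC.
Qed.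

Definition odd_pred (p : V -> bool) := forall v, v != 0 -> p (- v) = ~~ p v.

Definition nonzero s := all (fun v => v != 0) s.

Lemma ev_antip phi c : ev phi [seq antip s | s <- c] = ev (phi \o antip) c.
Proof. exact: ev_map. Qed.

Lemma sign_changes_antip ps s : nonzero s ->
  (forall i, (i < size ps)%N -> odd_pred (nth xpred0 ps i)) ->
  sign_changes ps (antip s) = sign_changes ps s.
Proof.
elim: ps s => [|p ps IH] [|v [|w s]] //= /andP[v0 ws] odd_p.
have [w0 _] := andP ws.
have o := odd_p 0%N isT; rewrite /= in o.
rewrite -[_ :: antip s]/(antip (w :: s)) IH// => [|i]; last exact: odd_p i.+1.
by rewrite !o//; case: (p v); case: (p w).
Qed.

(* Caps model the hemispheres of a flag of spheres: the boundary of each one is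
   the previous one together with its antipode. *)
Definition caps (cells : set (set V)) (m : nat) (h : nat -> seq (seq V)) :=
  [/\ exists v, h 0 = [:: [:: v]],
      forall k, (k <= m)%N -> {in h k, forall s,
        size s = k.+1 /\ exists2 C, cells C & forall v, v \in s -> C v} &
      forall k phi, (k < m)%N ->
        ev phi (lin bd (h k.+1)) = ev phi (h k) (+) ev (phi \o antip) (h k)].

(** Stokes turns the count on one cap into a count on the previous cap and its antipode, weighted by
    [p] at the first vertex. As [p] is odd, exactly one simplex of each antipodal pair has weight 1,
    which leaves the count for [ps]. The cells keep the vertices away from 0, where oddness says
    nothing. *)
Lemma caps_sign_changes cells m h ps : (forall C, cells C -> ~ C 0) ->
  caps cells m h -> (size ps <= m)%N ->
  (forall i, (i < size ps)%N -> odd_pred (nth xpred0 ps i)) ->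
  ev (sign_changes ps) (h (size ps)) = true.
Proof.
move=> cells0 [[v0 h0] hsz hbd]; elim: ps => [|p ps IH] //= szm odd_p.
  by rewrite h0 ev_cons ev_nil.
have odd_ps i : (i < size ps)%N -> odd_pred (nth xpred0 ps i) := odd_p i.+1.
have op : odd_pred p := odd_p 0%N isT.
rewrite -[RHS]IH//; last exact: ltnW.
transitivity (ev (fun s => ev (fun t => p (head 0 t) && sign_changes ps t) (bd s))
  (h (size ps).+1)).
  by apply: eq_ev => s /(hsz _ szm)[ss _]; rewrite sign_changes_coboundary.
rewrite -ev_lin hbd// -evD; apply: eq_ev => s /(hsz _ (ltnW szm))[] /=.
case: s => //= v s ss [C cC sC].
have s0 : nonzero (v :: s).
  by apply/allP => w /sC Cw; apply/eqP => w0; apply: (cells0 _ cC); rewrite -w0.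
rewrite -[_ :: antip s]/(antip (v :: s)) sign_changes_antip//.
by have /andP[v0' _] := s0; rewrite op// -andb_addl; case: (p v).
Qed.

End Chains.

(** * Barycentric subdivision *)

Section Subdivision.
Variables (R : realType) (V : lmodType R).
Implicit Types (s t : seq V) (c : seq (seq V)) (phi : seq V -> bool).

Definition bary s : V := (size s)%:R^-1 *: \sum_(v <- s) v.

(** The cone from the barycenter over the subdivided boundary; [n] stands for [size s] and makes the
    recursion structural. *)
Fixpoint sd n s : seq (seq V) :=
  if n is n'.+1 then [seq bary s :: t | t <- lin (sd n') (bd s)] else [:: [::]].

Lemma bary_antip s : bary (antip s) = - bary s.
Proof. by rewrite /bary size_map big_map sumrN scalerN. Qed.

Lemma sd_antip n s : sd n (antip s) = [seq antip t | t <- sd n s].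
Proof.
elim: n s => //= n IH s; rewrite bary_antip bd_antip -map_comp.
have -> : lin (sd n) [seq antip t | t <- bd s] =
          [seq antip t | t <- lin (sd n) (bd s)].
  by rewrite /lin map_flatten -!map_comp; congr flatten; apply: eq_map.
by rewrite -map_comp.
Qed.

Lemma size_sd n s t : size s = n -> t \in sd n s -> size t = n.
Proof.
elim: n s t => [|n IH] s t ss /=; first by rewrite inE => /eqP ->.
move=> /mapP[u /flattenP[_ /mapP[r /size_bd rs ->] /IH ur] ->] /=.
by rewrite ur//; apply/succn_inj; rewrite rs.
Qed.

(** Subdivision is a chain map. The boundary of the cone is its base plus the cone over the boundary
    of the base; by induction the latter boundary is the subdivision of [bd (bd s)], which
    vanishes. *)
Lemma bd_sd n s phi : size s = n.+1 ->
  ev phi (lin (@bd V) (sd n.+1 s)) = ev phi (lin (sd n) (bd s)).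
Proof.
elim: n s phi => [|n IH] s phi ss.
  by case: s ss => [|v []] //= _; rewrite !ev_lin !ev_cons !ev_nil /= !ev_cons !ev_nil.
rewrite [sd _ s]/= ev_lin ev_map.
under eq_ev do rewrite /= ev_cons ev_map.
rewrite evD -[X in _ (+) X]ev_lin -/(sd n.+1).
set psi := phi \o _; suff -> : ev psi (lin (@bd V) (lin (sd n.+1) (bd s))) = false.
  by rewrite addbF.
rewrite !ev_lin.
transitivity (ev (fun t => ev psi (lin (sd n) (bd t))) (bd s)).
  by apply: eq_ev => t /size_bd ts; rewrite -ev_lin IH//; apply/succn_inj; rewrite ts.
under eq_ev do rewrite ev_lin.
by rewrite -ev_lin ev_bdbd.
Qed.

(** Convexity, in the form that subdivision calls for. *)
Definition bary_closed (C : set V) :=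
  forall s, s != [::] -> (forall v, v \in s -> C v) -> C (bary s).

Lemma sd_hull n s t C : bary_closed C -> size s = n ->
  (forall v, v \in s -> C v) -> t \in sd n s -> forall v, v \in t -> C v.
Proof.
move=> bC; elim: n s t => [|n IH] s t ss sC /=; first by rewrite inE => /eqP ->.
move=> /mapP[u /flattenP[_ /mapP[r rs ->] ur] ->] v.
rewrite inE => /predU1P[->|].
  by apply: bC => //; case: s ss {sC rs}.
apply: IH ur v => [|v /(mem_bd rs)/sC//].
by apply/succn_inj; rewrite (size_bd rs).
Qed.

Definition sdh (h : nat -> seq (seq V)) k := lin (sd k.+1) (h k).

(** The boundary relation survives because [sd] is a chain map that commutes with the antipode. *)
Lemma caps_sdh cells m h : (forall C, cells C -> bary_closed C) ->
  caps cells m h -> caps cells m (sdh h).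
Proof.
move=> cellsb [[v0 h0] hsz hbd]; split.
- by exists (bary [:: v0]); rewrite /sdh h0.
- move=> k km t /flattenP[_ /mapP[s sh ->] ts].
  have [ss [C cC sC]] := hsz _ km _ sh; split; first exact: size_sd ts.
  by exists C => //; apply: sd_hull ts => //; exact: cellsb.
move=> k phi km.
rewrite !ev_lin.
transitivity (ev (fun s => ev (fun t => ev phi (sd k.+1 t)) (bd s)) (h k.+1)).
  apply: eq_ev => s /(hsz _ km)[ss _]; rewrite -ev_lin bd_sd// ev_lin//.
rewrite -[LHS]ev_lin hbd//; congr (_ (+) _).
by apply: eq_ev => s _; rewrite -ev_map -sd_antip.
Qed.

End Subdivision.

(** * Mesh of iterated subdivisions *)

Section Mesh.
Variables (R : realType) (V : normedModType R).
Implicit Types (s t : seq V) (C : set V).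

Lemma bary_sub s x : s != [::] -> bary s - x = bary [seq v - x | v <- s].
Proof.
move=> s0; rewrite /bary size_map big_map sumrB scalerBr big_const_seq.
rewrite count_predT iter_addr_0 -[x *+ _]scaler_nat scalerA mulVf ?scale1r//.
by rewrite pnatr_eq0 size_eq0.
Qed.

Lemma bary_ball x (r : R) : bary_closed [set v : V | `|v - x| <= r].
Proof.
move=> s s0 sr /=; rewrite bary_sub// /bary normrZ size_map big_map.
rewrite ger0_norm ?invr_ge0 ?ler0n// ler_pdivrMl; last first.
  by rewrite ltr0n lt0n size_eq0.
apply: le_trans (ler_norm_sum _ _ _) _.
rewrite big_seq mulr_natl -(count_predT s) -[leRHS]iter_addr_0 -big_const_seq.
by rewrite [leRHS]big_seq; apply: ler_sum.
Qed.

Lemma bary_dist s (m : nat) (D : R) w : w \in s -> (size s <= m.+1)%N ->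
  (forall v, v \in s -> `|v - w| <= D) ->
  `|bary s - w| <= m%:R / m.+1%:R * D.
Proof.
move=> ws sm sD; have D0 : 0 <= D by apply: le_trans (sD _ ws).
have s0 : (0 < size s)%N by case: s ws {sm sD}.
rewrite bary_sub -?size_eq0 -?lt0n// /bary size_map big_map normrZ.
(* The term of [w] vanishes, so with [k = size s] the average is at most [(k - 1) / k * D], and
   [(k - 1) / k] increases with [k]. *)
rewrite (big_rem w)//= subrr add0r.
rewrite ger0_norm ?invr_ge0 ?ler0n// ler_pdivrMl ?ltr0n//.
have -> : (size s)%:R * (m%:R / m.+1%:R * D) =
  (size s)%:R * m%:R / m.+1%:R * D :> R by rewrite !mulrA.
apply: le_trans (ler_norm_sum _ _ _) _.
apply: (@le_trans _ _ ((size s).-1%:R * D)).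
  rewrite -(size_rem ws) mulr_natl -(count_predT (rem w s)).
  rewrite -[leRHS]iter_addr_0 -big_const_seq.
  rewrite big_seq [leRHS]big_seq; apply: ler_sum => v /mem_rem; exact: sD.
apply: ler_wpM2r => //; rewrite ler_pdivlMr ?ltr0n// -!natrM ler_nat.
by case: (size s) s0 sm => //= k _; rewrite ltnS mulnS mulSn leq_add2r.
Qed.

Definition mesh_le (D : R) s := forall v w, v \in s -> w \in s -> `|v - w| <= D.

(** Two vertices on a subdivided face are handled by induction. Otherwise one is [bary s]: the ball
    around it of the new radius contains [s], hence, being convex, all vertices of the
    subdivision. *)
Lemma sd_mesh n s t (m : nat) (D : R) :
  size s = n -> (n <= m.+1)%N -> mesh_le D s ->
  t \in sd n s -> mesh_le (m%:R / m.+1%:R * D) t.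
Proof.
elim: n s t => [|n IH] s t ss nm sD /=; first by rewrite inE => /eqP ->.
move=> /mapP[u /flattenP[_ /mapP[r rs ->] ur] ->].
have uD : mesh_le (m%:R / m.+1%:R * D) u.
  apply: IH ur => //; first by apply/succn_inj; rewrite (size_bd rs).
  - exact: ltnW.
  - by move=> v w /(mem_bd rs) vs /(mem_bd rs) ws; exact: sD.
have D0 : 0 <= D.
  case: s ss sD {rs} => // x s _ /(_ x x); rewrite inE eqxx subrr normr0.
  by apply.
have bu w : w \in u -> `|w - bary s| <= m%:R / m.+1%:R * D.
  apply: (sd_hull (@bary_ball (bary s) _) _ _ ur).
    by apply/succn_inj; rewrite (size_bd rs).
  move=> v /(mem_bd rs) vs /=; rewrite distrC bary_dist// ?ss// => x xs.
  exact: sD.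
move=> v w; rewrite !inE => /predU1P[->|vu] /predU1P[->|wu].
- by rewrite subrr normr0 mulr_ge0// divr_ge0.
- by rewrite distrC bu.
- exact: bu.
- exact: uD.
Qed.

Lemma caps_fine cells m h (D d : R) : (forall C, cells C -> bary_closed C) ->
  caps cells m h -> (forall s, s \in h m -> mesh_le D s) -> 0 < d ->
  exists2 h', caps cells m h' & forall s, s \in h' m -> mesh_le d s.
Proof.
move=> cellsb hcaps hD d0.
(* The simplices of [h m] have [m.+1] vertices, so each subdivision contracts their mesh by
   [q < 1]. *)
pose q : R := m%:R / m.+1%:R.
have it N : caps cells m (iter N (@sdh _ _) h) /\
    forall s, s \in iter N (@sdh _ V) h m -> mesh_le (q ^+ N * D) s.
  elim: N => [|N [IHc IHD]]; first by split => // s; rewrite expr0 mul1r; exact: hD.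
  split; first exact: caps_sdh.
  move=> t /flattenP[_ /mapP[s sh ->] ts].
  have [_ /(_ m (leqnn _) _ sh)[ss _] _] := IHc.
  rewrite exprS -mulrA; exact: (sd_mesh ss _ (IHD _ sh) ts).
have q1 : `|q| < 1.
  by rewrite ger0_norm ?divr_ge0// ltr_pdivrMr ?ltr0n// mul1r ltr_nat.
have : (fun N => q ^+ N * D) @ \oo --> (0 * D).
  by apply: cvgM; [exact: cvg_expr|exact: cvg_cst].
rewrite mul0r => /cvgr0Pnorm_le /(_ _ d0)[N _ /(_ N (leqnn N)) /= Nd].
have [c sD] := it N; exists (iter N (@sdh _ _) h) => // s /sD sN v w vs ws.
by apply: le_trans (sN v w vs ws) _; apply: le_trans Nd; exact: ler_norm.
Qed.

End Mesh.

(** * The octahedron *)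

Section RowNorm.
Variables (R : realType) (n : nat).

Lemma rV_norm_le (x : 'rV[R]_n) (r : R) :
  0 <= r -> (forall i, `|x ord0 i| <= r) -> `|x| <= r.
Proof.
move=> r0 xr; rewrite -[leLHS]/(mx_norm x) mx_normrE.
by apply: bigmax_le => //= -[j i] _ /=; rewrite ord1.
Qed.

End RowNorm.

Section Octahedron.
Variables (R : realType) (m : nat).
Local Notation V := 'rV[R]_m.+1.

(** A facet of the unit sphere of the 1-norm; within one orthant the norm is linear, which makes the
    facet convex. *)
Definition oct_face (eps : 'I_m.+1 -> bool) : set V :=
  [set v | (forall i, 0 <= (-1) ^+ eps i * v ord0 i) /\
           \sum_i (-1) ^+ eps i * v ord0 i = 1].

Lemma oct_face_neq0 eps : ~ oct_face eps 0.
Proof.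
by case=> _ /eqP; rewrite big1 ?(eq_sym 0) ?oner_eq0// => i _; rewrite mxE mulr0.
Qed.

Lemma oct_face_norm1 eps v : oct_face eps v -> \sum_i `|v ord0 i| = 1.
Proof.
case=> v0 <-; apply: eq_bigr => i _; rewrite -(ger0_norm (v0 i)) normrM.
by rewrite normrX normrN1 expr1n mul1r.
Qed.

Lemma bary_coord (s : seq V) i :
  bary s ord0 i = (size s)%:R^-1 * \sum_(v <- s) v ord0 i.
Proof. by rewrite !mxE summxE. Qed.

Lemma oct_face_bary eps : bary_closed (oct_face eps).
Proof.
move=> s s0 sC; split => [i|].
  rewrite bary_coord mulrCA mulr_ge0 ?invr_ge0// mulr_sumr big_seq.
  by apply: sumr_ge0 => v /sC[].
under eq_bigr => i _ do rewrite bary_coord mulrCA mulr_sumr.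
rewrite -mulr_sumr exchange_big/= big_seq (eq_bigr (fun=> 1)); last first.
  by move=> v /sC[].
rewrite -big_seq big_const_seq count_predT iter_addr_0 mulVf//.
by rewrite pnatr_eq0 size_eq0.
Qed.

Definition pole (k : nat) : V := delta_mx ord0 (inord k).

(** The next hemisphere is the cone from a new pole over the whole sphere formed by the previous
    hemisphere and its antipode. *)
Fixpoint oct k : seq (seq V) :=
  if k is k'.+1
  then [seq pole k :: s | s <- oct k' ++ [seq antip s | s <- oct k']]
  else [:: [:: pole 0]].

Lemma octS k :
  oct k.+1 = [seq pole k.+1 :: s | s <- oct k ++ [seq antip s | s <- oct k]].
Proof. by []. Qed.

Lemma pole_coord k (i : 'I_m.+1) : (k <= m)%N ->
  pole k ord0 i = (i == k :> nat)%:R.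
Proof. by move=> km; rewrite mxE/= -val_eqE /= inordK. Qed.

Lemma oct_face_pole eps k : (k <= m)%N -> eps (inord k) = false ->
  oct_face eps (pole k).
Proof.
move=> km ek; have E i : (-1) ^+ eps i * pole k ord0 i = (i == inord k)%:R.
  rewrite mxE /=; case: eqP => [->|]; rewrite ?mulr0// ek mulr1//.
split=> [i|]; first by rewrite E ler0n.
rewrite (eq_bigr _ (fun i _ => E i)) (bigD1 (inord k))//= eqxx big1 ?addr0// => i.
by move=> /negPf ->.
Qed.

Lemma oct_antip_face (eps : 'I_m.+1 -> bool) v :
  oct_face eps v -> oct_face (fun i => ~~ eps i) (- v).
Proof.
have E i : (-1) ^+ (~~ eps i) * (- v) ord0 i = (-1) ^+ eps i * v ord0 i.
  by rewrite mxE signrN mulrNN.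
by case=> v0 v1; split=> [i|]; [rewrite E|rewrite (eq_bigr _ (fun i _ => E i))].
Qed.

Lemma octP k s : (k <= m)%N -> s \in oct k -> size s = k.+1 /\
  exists eps, forall v, v \in s -> oct_face eps v /\
    forall i : 'I_m.+1, (k < i)%N -> v ord0 i = 0.
Proof.
elim: k s => [|k IH] s km.
  rewrite inE => /eqP ->; split=> //; exists (fun=> false) => v.
  rewrite inE => /eqP ->; split; first exact: oct_face_pole.
  by move=> i i0; rewrite pole_coord// gtn_eqF.
move=> /mapP[t tk ->].
have [/= -> [eps tC]] : size t = k.+1 /\
    exists eps, forall v, v \in t -> oct_face eps v /\
    forall i : 'I_m.+1, (k < i)%N -> v ord0 i = 0.
  move: tk; rewrite mem_cat => /orP[/(IH _ (ltnW km))//|].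
  move=> /mapP[u /(IH _ (ltnW km))[us [eps uC]] ->].
  rewrite size_map; split => //; exists (fun i => ~~ eps i) => _ /mapP[v /uC[vC v0] ->].
  split; first exact: oct_antip_face.
  by move=> i /v0; rewrite mxE => ->; rewrite oppr0.
(* Coordinate [k.+1] vanishes on [t], so its sign can be reset to that of the new pole. *)
split => //; pose eps' i := if i == inord k.+1 then false else eps i.
exists eps' => v; rewrite inE => /predU1P[->|/tC[[vp v1] v0]].
  split; first by apply: oct_face_pole; rewrite // /eps' eqxx.
  by move=> i ik; rewrite pole_coord// gtn_eqF.
split; last by move=> i /ltnW; exact: v0.
have E i : (-1) ^+ eps' i * v ord0 i = (-1) ^+ eps i * v ord0 i.
  by rewrite /eps'; case: eqP => // ->; rewrite v0 ?mulr0// inordK.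
by split=> [i|]; [rewrite E|rewrite (eq_bigr _ (fun i _ => E i))].
Qed.

(** The base of the cone is a cycle: the boundary of the previous hemisphere is invariant under the
    antipode, so it cancels against its antipodal copy. *)
Lemma bd_oct k phi : ev phi (lin (@bd V) (oct k.+1)) =
  ev phi (oct k) (+) ev (phi \o @antip V) (oct k).
Proof.
elim: k phi => [|k IH] phi.
  by rewrite !ev_lin /= !ev_cons !ev_nil /=; do 3 case: (phi _).
rewrite ev_lin octS ev_map.
under eq_ev do rewrite /= ev_cons ev_map.
rewrite evD -[X in _ (+) X]ev_lin ev_cat ev_antip.
set psi := phi \o cons _.
suff -> : ev psi (lin (@bd V) (oct k.+1 ++ [seq antip s | s <- oct k.+1])) = false.
  by rewrite addbF.
rewrite ev_lin ev_cat ev_antip.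
under [X in _ (+) X]eq_ev do rewrite /= bd_antip ev_antip.
rewrite -!ev_lin !IH.
have -> : ev ((psi \o @antip V) \o @antip V) (oct k) = ev psi (oct k).
  by apply: eq_ev => s _ /=; rewrite /antip -map_comp (@eq_map _ _ _ id) ?map_id//
    => v /=; rewrite opprK.
by case: (ev psi _); case: (ev (psi \o _) _).
Qed.

Lemma caps_oct : caps (range oct_face) m oct.
Proof.
split; [by exists (pole 0)| |by move=> k phi _; exact: bd_oct].
move=> k km s /(octP km)[ss [eps sC]]; split => //.
by exists (oct_face eps) => [|v /sC[]//]; exists eps.
Qed.

Lemma oct_mesh s : s \in oct m -> mesh_le 2 s.
Proof.
move=> /(octP (leqnn m))[_ [eps sC]].
have b v : v \in s -> `|v| <= 1.
  move=> /sC[/oct_face_norm1 v1 _]; apply: rV_norm_le => // i.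
  by rewrite -[leRHS]v1 (bigD1 i)//= lerDl sumr_ge0.
move=> v w vs ws; apply: le_trans (ler_normB _ _) _.
by rewrite -[leRHS]/(1 + 1) lerD// b.
Qed.

End Octahedron.

(** * The Borsuk-Ulam theorem *)

Section BorsukUlam.
Variables (R : realType).

Lemma sign_changes_nth (V : zmodType) ps (s : seq V) i :
  sign_changes ps s -> size s = (size ps).+1 ->
  (i < size ps)%N ->
  nth xpred0 ps i (nth 0 s i) != nth xpred0 ps i (nth 0 s i.+1).
Proof.
elim: ps s i => [|p ps IH] [|v [|w s]] // [|i] /andP[pvw Ws] [ss] ip.
  by move: pvw => /=; case: (p v); case: (p w).
by apply: (IH (w :: s)); rewrite //= ss.
Qed.

(** Breaks ties in [sign_pred] where the function vanishes. The selected coordinate depends only on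
    the support, so it is the same for [v] and [- v]. *)
Definition lead_pos n (v : 'rV[R]_n.+1) : bool :=
  0 < v ord0 (odflt ord0 [pick i | v ord0 i != 0]).

Lemma odd_lead_pos n : odd_pred (@lead_pos n).
Proof.
move=> v v0; rewrite /lead_pos; set a := odflt _ _.
have -> : a = odflt ord0 [pick i | v ord0 i != 0].
  by congr odflt; apply: eq_pick => i; rewrite mxE oppr_eq0.
rewrite mxE oppr_gt0; case: pickP => [i vi|v0'] /=.
  by rewrite lt_neqAle vi -leNgt.
case/eqP: v0; apply/rowP => i; rewrite mxE.
by have /negbFE/eqP := v0' i.
Qed.

Definition sign_pred n (g : 'rV[R]_n.+1 -> R) v : bool :=
  if g v == 0 then lead_pos v else 0 < g v.

Lemma odd_sign_pred n (g : 'rV[R]_n.+1 -> R) :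
  (forall v, v != 0 -> g (- v) = - g v) -> odd_pred (sign_pred g).
Proof.
move=> og v v0; rewrite /sign_pred og// oppr_eq0; case: ifPn => gv0.
  exact: odd_lead_pos.
by rewrite oppr_gt0 -leNgt lt_neqAle gv0.
Qed.

Lemma compact_sphere1 n : compact [set v : 'rV[R]_n | \sum_i `|v ord0 i| = 1].
Proof.
apply: bounded_closed_compact.
  rewrite /= /bounded_near; near=> M => v /= v1; apply: (@le_trans _ _ 1); last first.
    by near: M; exact: nbhs_pinfty_ge.
  by apply: rV_norm_le => // i; rewrite -v1 (bigD1 i)//= lerDl sumr_ge0.
have c : continuous (fun v : 'rV[R]_n => \sum_i `|v ord0 i|).
  apply: (@continuous_big R^o 'I_n +%R 0 xpredT add_continuous) => i _ v.
  apply: (@continuous_comp _ _ _ (fun v : 'rV[R]_n => v ord0 i) Num.norm).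
    exact: coord_continuous.
  exact: norm_continuous.
rewrite -[X in closed X]/((fun v : 'rV[R]_n => \sum_i `|v ord0 i|) @^-1` [set 1]).
by apply: closed_comp => [v _|]; [exact: c|exact: closed_eq].
Unshelve. all: by end_near. Qed.

(** Continuity and oddness are asked only off 0 because the maps to come are composed with radial
    normalization. *)
Theorem borsuk_ulam m (g : 'I_m -> 'rV[R]_m.+1 -> R) :
  (forall i v, v != 0 -> {for v, continuous (g i)}) ->
  (forall i v, v != 0 -> g i (- v) = - g i v) ->
  exists2 v, v != 0 & forall i, g i v = 0.
Proof.
move=> gc go; apply: contrapT => nz.
have {}nz v : v != 0 -> exists i, g i v != 0.
  move=> v0; apply: contrapT => nv; apply: nz; exists v => // i.
  by apply/eqP/negPn/negP => gi; apply: nv; exists i.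
(* Some coordinate has a constant strict sign on the closed ball of radius [r] around [y].
   Compactness yields one [r] for the whole sphere, as with a Lebesgue number. *)
pose P (r : R) (y : 'rV[R]_m.+1) := exists i (b : bool),
  forall z, `|y - z| <= r -> g i z != 0 /\ (0 < g i z) = b.
have : \forall r \near 0^'+, [set v : 'rV[R]_m.+1 | \sum_i `|v ord0 i| = 1] `<=` P r.
  have /compact_near_coveringP := @compact_sphere1 m.+1; apply => x x1.
  have x0 : x != 0.
    apply/eqP => x0; move: x1; rewrite /= x0 big1 => [/eqP|i _].
      by rewrite eq_sym oner_eq0.
    by rewrite mxE normr0.
  have [i gi] := nz _ x0.
  have : \forall z \near x, g i z != 0 /\ (0 < g i z) = (0 < g i x).
    case: (ltrP 0 (g i x)) => gx.
      near=> z; have gz : 0 < g i z by near: z; exact: (cvgr_gt _ (gc i x x0)).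
      by rewrite gz gt_eqF.
    have {}gx : g i x < 0 by rewrite lt_neqAle gi.
    near=> z; have gz : g i z < 0 by near: z; exact: (cvgr_lt _ (gc i x x0)).
    by rewrite lt_eqF// ltNge ltW.
  move=> /nbhs_ballP[e /= e0 xe].
  exists (ball x (e / 2), [set r | r < e / 2]) => [|[y r] /= [xy re]].
    split; first by apply: nbhsx_ballx; rewrite divr_gt0.
    by apply: nbhs_right_lt; rewrite divr_gt0.
  exists i, (0 < g i x) => z yz; apply: xe.
  rewrite -ball_normE/= (splitr e); apply: le_lt_trans (ler_distD y _ _) _.
  apply: ltrD; first by move: xy; rewrite -ball_normE.
  exact: le_lt_trans yz re.
move=> nearP; near (0 : R)^'+ => r.
have rP : [set v : 'rV[R]_m.+1 | \sum_i `|v ord0 i| = 1] `<=` P r.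
  by near: r; exact: nearP.
have r0 : 0 < r by near: r; exact: nbhs_right_gt.
have cb (C : set 'rV[R]_m.+1) : range (@oct_face R m) C -> bary_closed C.
  by move=> [eps _ <-]; exact: oct_face_bary.
have [h hc hr] := caps_fine cb (@caps_oct R m) (@oct_mesh R m) r0.
pose ps := [seq sign_pred (g i) | i <- enum 'I_m].
have sps : size ps = m by rewrite size_map size_enum_ord.
have psE (i : 'I_m) : nth xpred0 ps i = sign_pred (g i).
  by rewrite (nth_map i) ?size_enum_ord// nth_ord_enum.
have : ev (sign_changes ps) (h (size ps)) = true.
  apply: (caps_sign_changes _ hc) => [_ [eps _ <-]||i im]; first exact: oct_face_neq0.
    by rewrite sps.
  rewrite sps in im; rewrite (psE (Ordinal im)).
  by apply: odd_sign_pred => v; exact: go.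
rewrite sps.
(* An odd count is nonzero, so some simplex [s] of mesh at most [r] carries all the sign changes. *)
have [/hasP[s sh Ws] _|/hasPn nW] := boolP (has (sign_changes ps) (h m)); last first.
  by rewrite /ev big_seq big1// => s /nW /negPf.
have [_ /(_ m (leqnn m) _ sh)[ss [_ [eps _ <-] sC]] _] := hc.
have vs i : (i <= m)%N -> nth 0 s i \in s by move=> im; rewrite mem_nth// ss.
(* Near the first vertex, hence on all of [s], coordinate [i] keeps its sign, against its change
   between vertices [i] and [i.+1]. *)
have /rP[i [b ib]] : \sum_i `|(nth 0 s 0) ord0 i| = 1.
  by apply: (@oct_face_norm1 _ _ eps); apply/sC/vs.
have si j : (j <= m)%N -> sign_pred (g i) (nth 0 s j) = b.
  move=> jm; have [|g0 gb] := ib (nth 0 s j).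
    by apply: hr sh _ _ (vs _ _) (vs _ _).
  by rewrite /sign_pred (negPf g0).
have := @sign_changes_nth _ ps s i Ws; rewrite sps => /(_ ss (ltn_ord i)).
by rewrite psE !si ?eqxx// ltnW.
Unshelve. all: by end_near. Qed.

End BorsukUlam.

(** * Genus of the p-sphere *)

Section PSphere.
Variables (R : realType) (p : R).
Hypothesis p0 : 0 < p.

Lemma continuous_powR x : 0 < x -> {for x, continuous (fun y : R => y `^ p)}.
Proof.
move=> x0; apply: differentiable_continuous; apply/derivable1_diffP.
by apply: derivable_powR; rewrite in_itv/= x0.
Qed.

Lemma continuous_norm_powR : continuous (fun x : R => `|x| `^ p).
Proof.
move=> x; have [->|x0] := eqVneq x 0; last first.
  apply: (@cvg_comp _ _ _ Num.norm (fun y : R => y `^ p) _ (nbhs `|x|)).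
    exact: norm_continuous.
  by apply: continuous_powR; rewrite normr_gt0.
rewrite /continuous_at normr0 powR0 ?gt_eqF//.
apply/cvgr0Pnorm_lt => e e0; near=> y.
rewrite ger0_norm ?powR_ge0//.
have -> : e = (e `^ p^-1) `^ p.
  by rewrite -powRrM mulVf ?gt_eqF// powRr1// ltW.
apply: gt0_ltr_powR => //; rewrite ?nnegrE ?powR_ge0//.
rewrite -[y]subr0 distrC; near: y.
by apply: (@cvgr_dist_lt _ _ _ (nbhs (0:R)) _ id 0 cvg_id); rewrite powR_gt0.
Unshelve. all: by end_near. Qed.

Variable n : nat.
Implicit Types v : 'rV[R]_n.

Lemma continuous_pnorm : continuous (@pnorm_p R n p).
Proof.
apply: (@continuous_big R^o 'I_n +%R 0 xpredT add_continuous) => i _ v.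
apply: (@continuous_comp _ _ _ (fun v : 'rV[R]_n => v ord0 i)
  (fun x : R => `|x| `^ p)); first exact: coord_continuous.
exact: continuous_norm_powR.
Qed.

Lemma pnormZ a v : pnorm_p p (a *: v) = `|a| `^ p * pnorm_p p v.
Proof.
rewrite /pnorm_p mulr_sumr; apply: eq_bigr => i _.
by rewrite /ent mxE normrM powRM.
Qed.

Lemma pnormN v : pnorm_p p (- v) = pnorm_p p v.
Proof. by apply: eq_bigr => i _; rewrite /ent mxE normrN. Qed.

Lemma pnorm_gt0 v : v != 0 -> 0 < pnorm_p p v.
Proof.
move=> v0; have [i vi] : exists i, v ord0 i != 0.
  apply: contrapT => nv; case/eqP: v0; apply/rowP => i; rewrite mxE.
  by apply/eqP/negPn/negP => vi; apply: nv; exists i.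
rewrite /pnorm_p (bigD1 i)//= ltr_pwDl ?powR_gt0 ?normr_gt0//.
by apply: sumr_ge0 => *; exact: powR_ge0.
Qed.

Definition pnormalize v := (pnorm_p p v `^ p^-1)^-1 *: v.

Lemma pnormalize_sphere v : v != 0 -> sphere_p p (pnormalize v).
Proof.
move=> /pnorm_gt0 v0; rewrite /sphere_p /= pnormZ -powRN ger0_norm ?powR_ge0//.
by rewrite -powRrM mulNr mulVf ?gt_eqF// powR_inv1 ?ltW// mulVf ?gt_eqF.
Qed.

Lemma pnormalizeN v : pnormalize (- v) = - pnormalize v.
Proof. by rewrite /pnormalize pnormN scalerN. Qed.

Lemma continuous_pnormalize v : v != 0 -> {for v, continuous pnormalize}.
Proof.
move=> v0; apply: (@cvgZ _ _ _ (nbhs v) (nbhs_filter v)); last exact: cvg_id.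
apply: cvgV; first by rewrite gt_eqF// powR_gt0// pnorm_gt0.
apply: (@continuous_comp _ _ _ (@pnorm_p R n p) (fun y : R => y `^ p^-1)).
  exact: continuous_pnorm.
apply: differentiable_continuous; apply/derivable1_diffP.
by apply: derivable_powR; rewrite in_itv/= pnorm_gt0.
Qed.

Lemma closed_sphere : closed (@sphere_p R n p).
Proof.
rewrite -[X in closed X]/(@pnorm_p R n p @^-1` [set 1]).
by apply: closed_comp => [v _|]; [exact: continuous_pnorm|exact: closed_eq].
Qed.

Lemma symmetric_sphere : symmetric_set (@sphere_p R n p).
Proof. by move=> v; rewrite /sphere_p /= pnormN. Qed.

Lemma sphere_coord_le1 v i : sphere_p p v -> `|v ord0 i| <= 1.
Proof.
rewrite /sphere_p /= => v1; rewrite leNgt; apply/negP => vi.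
have := @gt0_ltr_powR _ _ p0 1 `|v ord0 i|.
rewrite !nnegrE normr_ge0 ler01 => /(_ isT isT vi).
rewrite powR1 -{1}v1 /pnorm_p (bigD1 i)//= -[X in _ < X]addr0 ltrD2l ltNge.
by rewrite sumr_ge0// => j _; exact: powR_ge0.
Qed.

End PSphere.

Lemma col'_continuous (T : topologicalType) m n (j0 : 'I_n.+1) :
  continuous (col' j0 : 'M[T]_(m, n.+1) -> 'M[T]_(m, n)).
Proof.
move=> M A [P MP PA].
(* Neighbourhoods of a matrix are entrywise; the deleted column is left unconstrained. *)
exists (fun i j => if unlift j0 j is Some k then P i k else setT).
  move=> i j; case: unliftP => [k ->|_]; last exact: filterT.
  by have := MP i k; rewrite mxE.
by move=> N NP; apply: PA => i k; have := NP i (lift j0 k); rewrite liftK mxE.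
Qed.

Section Genus.
Variables (R : realType) (p : R).
Hypothesis p0 : 0 < p.

Lemma genus_sphere n : genus_ge (@sphere_p R n p) n.
Proof.
case: n => [|m] // j jm [g [gc [go g0]]].
(* The [j <= m] coordinates of [g] are padded with zeros to [m] functions. *)
pose G (i : 'I_m) (v : 'rV[R]_m.+1) : R :=
  oapp (fun k : 'I_j => g (pnormalize p v) ord0 k) 0 (insub (val i)).
have [i v v0|i v v0|v v0 Gv] := @borsuk_ulam R m G.
- rewrite /G; case: insub => [k|] /=; last first.
    exact: cst_continuous.
  apply: (@cvg_comp _ _ _ (fun x => g (pnormalize p x)) (fun w => w ord0 k) _
    (nbhs (g (pnormalize p v)))); last exact: coord_continuous.
  (* Continuity within the sphere suffices, since [pnormalize] sends all points near [v] into it. *)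
  have gn := (subspace_continuousP _ _).1 gc _ (pnormalize_sphere p0 v0).
  apply: cvg_comp gn => A /= nA.
  have := continuous_pnormalize p0 v0 nA.
  have : \forall x \near v, sphere_p p (pnormalize p x).
    have : \forall x \near v, 0 < `|x|.
      by apply: (cvgr_gt _ (@norm_continuous _ _ v)); rewrite normr_gt0.
    by apply: filterS => x; rewrite normr_gt0 => x0; exact: pnormalize_sphere.
  by apply: filterS2 => x sx; apply.
- rewrite /G pnormalizeN; case: insub => [k|] /=; last by rewrite oppr0.
  by rewrite go ?mxE//; exact: pnormalize_sphere.
have /eqP := g0 _ (pnormalize_sphere p0 v0); apply; apply/rowP => k.
have km : (k < m)%N by apply: leq_trans (ltn_ord k) _; rewrite -ltnS.
have := Gv (Ordinal km); rewrite /G /= insubT ?ltn_ord// => kj.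
by rewrite mxE /=; move=> <-; congr (g _ _ _); exact/val_inj.
Qed.

(* A symmetric set missing [x] misses [- x] too, so the projection along [x] is
   a nonvanishing odd map on it. *)
Lemma genus_full n (B : set 'rV[R]_n) x : symmetric_set B ->
  B `<=` sphere_p p -> genus_ge B n -> sphere_p p x -> B x.
Proof.
case: n B x => [|m] B x Bs Bp gB xp.
  by exfalso; move: xp; rewrite /sphere_p /= /pnorm_p big_ord0 => /eqP;
    rewrite eq_sym oner_eq0.
apply: contrapT => nBx.
have [i xi] : exists i, x ord0 i != 0.
  apply: contrapT => nx; move: xp; rewrite /sphere_p /= /pnorm_p big1 => [/eqP|i _].
    by rewrite eq_sym oner_eq0.
  have /eqP xi : x ord0 i == 0 by apply/negPn/negP => xi; apply: nx; exists i.
  by rewrite /ent xi normr0 powR0 ?gt_eqF.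
apply: (gB m (ltnSn m)).
(* Coordinate [i] of [pr f] is 0, so deleting it loses nothing and lands in dimension [m]. *)
pose pr (f : 'rV[R]_m.+1) := f - (f ord0 i / x ord0 i) *: x.
have prc : continuous pr.
  move=> f; apply: (@cvgB _ _ _ (nbhs f) (nbhs_filter f)); first exact: cvg_id.
  apply: (@cvgZr_tmp _ _ _ (nbhs f) (nbhs_filter f)).
  apply: (@cvgMr_tmp _ _ (nbhs f) (nbhs_filter f)); exact: coord_continuous.
exists (fun f => col' i (pr f)); split; last split.
- apply: continuous_subspaceT => f.
  apply: (@cvg_comp _ _ _ pr (col' i) _ (nbhs (pr f))); first exact: prc.
  exact: col'_continuous.
- move=> f _; apply/rowP => k; by rewrite !mxE mulNr mulNr opprB opprK addrC.
move=> f Bf; apply/eqP => /rowP fx; apply: nBx.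
(* A zero of the projection is a multiple of [x], and on the sphere it is [x] or [- x]. *)
have {}fx : f = (f ord0 i / x ord0 i) *: x.
  apply/rowP => k; rewrite mxE; case: (unliftP i k) => [k' ->|->].
    by have := fx k'; rewrite !mxE => /eqP; rewrite subr_eq0 => /eqP.
  by rewrite divfK.
have := Bp _ Bf; rewrite /sphere_p /= fx pnormZ xp mulr1 => /eqP.
rewrite powR_eq1 ltNge normr_ge0 (gt_eqF p0) !orbF eqr_norml ler01 andbT.
case/orP => /eqP t; rewrite t in fx; first by rewrite -(scale1r x) -fx.
by rewrite -[x]opprK -(scaleN1r x) -fx; exact: Bs.
Qed.

End Genus.

(** * Rayleigh quotients and the top eigenvalue *)

Section Rayleigh.
Variables (R : realType) (n : nat) (e : rel 'I_n) (sigma : 'I_n -> 'I_n -> R).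
Hypothesis sg : signature e sigma.
Variable p : R.
Hypothesis p0 : 0 < p.

Lemma sigma_norm i j : e i j -> `|sigma i j| = 1.
Proof. by case/(sg.2) => ->; rewrite ?normrN normr1. Qed.

(** Makes [sup] a genuine upper bound. Coordinates on the sphere are at most 1 in absolute value, so
    each edge contributes at most [2 ^ p]. *)
Lemma rayleigh_bounded : has_ubound (rayleigh e sigma p @` sphere_p p).
Proof.
exists (\sum_(i < n) \sum_(j < n | (i < j)%N && e i j) 2 `^ p) => _ [f fp <-].
rewrite /rayleigh [pnorm_p _ _]fp divr1; apply: ler_sum => i _; apply: ler_sum.
move=> j /andP[_ /sigma_norm sij]; apply: (ge0_ler_powR (ltW p0)); rewrite ?nnegrE//.
apply: le_trans (ler_normB _ _) _; rewrite -[leRHS]/(1 + 1) normrM sij mul1r.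
by apply: lerD; exact: sphere_coord_le1 fp.
Qed.

(* On [f = 2^(-1/p) (e_i - sigma_ij e_j)] the edge [{i, j}] alone contributes
   [2^p / 2]. *)
Lemma rayleigh_test (i j : 'I_n) : (i < j)%N -> e i j ->
  exists2 f, sphere_p p f & 2 `^ p / 2 <= rayleigh e sigma p f.
Proof.
move=> ij eij.
pose u : 'rV[R]_n := delta_mx ord0 i - sigma i j *: delta_mx ord0 j.
have ji : j != i by rewrite -val_eqE gtn_eqF.
have ui : u ord0 i = 1 by rewrite !mxE !eqxx /= (eq_sym i) (negPf ji) mulr0 subr0.
have uj : u ord0 j = - sigma i j.
  by rewrite !mxE !eqxx /= (negPf ji) mulr1 sub0r.
have uk k : k != i -> k != j -> u ord0 k = 0.
  by move=> ki kj; rewrite !mxE /= (negPf ki) (negPf kj) mulr0 subr0.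
pose a : R := 2 `^ (- p^-1).
have ap : a `^ p = 2^-1 by rewrite -powRrM mulNr mulVf ?gt_eqF// powR_inv1.
have fp : sphere_p p (a *: u).
  rewrite /sphere_p /= pnormZ ger0_norm ?powR_ge0// ap /pnorm_p /ent.
  rewrite (bigD1 i)//= (bigD1 j)//= big1 => [|k /andP[ki kj]]; last first.
    by rewrite uk// normr0 powR0 ?gt_eqF.
  by rewrite ui uj normrN (sigma_norm eij) normr1 powR1 addr0 mulVf.
exists (a *: u) => //; rewrite /rayleigh [pnorm_p _ _]fp divr1.
rewrite (bigD1 i)//= (bigD1 j) ?ij//=.
(* For either sign, [sigma i j] squares to 1. *)
have -> : ent (a *: u) i - sigma i j * ent (a *: u) j = a * 2.
  rewrite /ent [(a *: u) ord0 i]mxE [(a *: u) ord0 j]mxE ui uj.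
  by case: (sg.2 i j eij) => ->;
    rewrite ?(mulN1r, mul1r) ?mulrN ?opprK !mulr1 ?opprK mulr_natr mulr2n.
rewrite normrM !ger0_norm ?powR_ge0// powRM ?powR_ge0// ap mulrC -addrA lerDl.
by rewrite addr_ge0// sumr_ge0// => k _; rewrite ?sumr_ge0// => *; exact: powR_ge0.
Qed.

Lemma lambda_top_ge (i j : 'I_n) : (i < j)%N -> e i j ->
  2 `^ p / 2 <= lambda_p e sigma p n.
Proof.
move=> ij eij; apply: lb_le_inf.
  (* Borsuk-Ulam enters here: it makes the sphere admissible, so that the infimum is not the default
     value of an empty set. *)
  exists (sup (rayleigh e sigma p @` sphere_p p)); exists (sphere_p p) => //.
  split; [exact: closed_sphere|split; [exact: symmetric_sphere|]].
  by split=> //; exact: genus_sphere.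
move=> _ [B [_ [Bs [Bp gB]]] ->].
have [f fp /le_trans] := rayleigh_test ij eij; apply; apply: ub_le_sup.
  have [M MB] := rayleigh_bounded; exists M => _ [g /Bp gp <-].
  by apply: MB; exists g.
by exists f => //; exact: genus_full gB fp.
Qed.

End Rayleigh.

(** All quotients are 0, so each set of values is empty or [{0}]; [sup] and [inf] give 0 in both
    cases. *)
Lemma lambda_no_edge (R : realType) n (e : rel 'I_n)
  (sigma : 'I_n -> 'I_n -> R) p k :
  (forall i j, ~~ e i j) -> lambda_p e sigma p k = 0.
Proof.
move=> ne.
have r0 f : rayleigh e sigma p f = 0.
  rewrite /rayleigh big1 ?mul0r// => i _; rewrite big1// => j.
  by rewrite (negPf (ne i j)) andbF.
have s0 (B : set 'rV[R]_n) : sup (rayleigh e sigma p @` B) = 0.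
  have /subset_set1[->|->] : rayleigh e sigma p @` B `<=` [set 0].
    by move=> _ [f _ <-]; rewrite r0.
  - exact: sup0.
  - exact: sup1.
rewrite /lambda_p; set S := [set _ | _].
have /subset_set1[->|->] : S `<=` [set 0] by move=> _ [B _ ->]; rewrite s0.
- exact: inf0.
- exact: inf1.
Qed.

Theorem theorem8p3 (R : realType) (n : nat) (e : rel 'I_n)
  (sigma : 'I_n -> 'I_n -> R) :
  simple_graph e -> signature e sigma ->
  ((forall k : nat, (1 <= k <= n)%N ->
      (2 `^ (- p) * lambda_p e sigma p k) @[p --> +oo] --> (0 : R))
   <-> (forall i j : 'I_n, ~~ e i j)).
Proof.
move=> eg sg; split=> [L0 i j|ne k _]; last first.
  under eq_cvg do rewrite lambda_no_edge// mulr0.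
  exact: cvg_cst.
apply/negP => eij.
wlog ij : i j eij / (i < j)%N.
  move=> H; case: (ltngtP i j) => [|ji|/val_inj ij]; first exact: H.
    by apply: (H j i) => //; rewrite eg.1.
  by have := eg.2 i; rewrite {2}ij eij.
have n0 : (0 < n)%N by apply: leq_trans (ltn_ord i).
(* The top index alone gives the contradiction: its scaled eigenvalue tends to 0 yet stays at least
   1/2. *)
have := L0 n; rewrite n0 leqnn => /(_ isT) L.
have half0 : (0 : R) < 2^-1 by rewrite invr_gt0.
near +oo_R => p.
have p0 : 0 < p by near: p; exact: nbhs_pinfty_gt.
have : 2 `^ (- p) * lambda_p e sigma p n < 2^-1 by near: p; exact: cvgr_lt L _ half0.
rewrite powRN ltNge ler_pdivlMl ?powR_gt0//.
by rewrite (lambda_top_ge sg p0 ij eij).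
Unshelve. all: by end_near. Qed.
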